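(* For every prime $m$, the function $g_m:\mathbb{N}\to\mathbb{N}\setminus\mathbb{P}$ is surjective, i.e. for every $x\in\mathbb{N}\setminus\mathbb{P}$ there is $n\in\mathbb{N}$ with $g_m(n)=x$.
   Context: $\mathbb{N}=\{0,1,2,\dots\}$, $\mathbb{P}$ is the set of prime numbers. For an integer $m\ge 2$, an $m$-product sequence is a finite sequence of integers $a_1\le a_2\le\dots\le a_t$ such that $\prod_{i=1}^t a_i=R^m$ for some $R\in\mathbb{N}$ and no integer appears more than $m-1$ times in the sequence. For $n\in\mathbb{N}$, $g_m(n)$ is the least integer $s$ such that there exists an $m$-product sequence $a_1\le\dots\le a_t$ with $a_1=n$ and $a_t=s$. *)

(* Defs.v *)
From mathcomp Require Import all_boot all_order all_algebra.
From mathcomp Require Import boolp.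

Set Implicit Arguments.
Unset Strict Implicit.
Unset Printing Implicit Defensive.

Import Order.TTheory GRing.Theory Num.Theory.
Local Open Scope ring_scope.

Definition product_sequence (m : nat) (a : seq int) : Prop :=
  [/\ sorted <=%R a,
      exists R : nat, \prod_(z <- a) z = R%:Z ^+ m
    & forall z : int, (count_mem z a <= m.-1)%N].

(* The sequence is [n%:Z :: b], so that it is nonempty with first term n. Its
   last term is at least n, hence it loses nothing to take s in nat. *)
Definition reaches (m n s : nat) : Prop :=
  exists b : seq int,
    product_sequence m (n%:Z :: b) /\ last n%:Z b = s%:Z.

(* Witnesses: the sequence 0, and n followed by m - 1 copies of 2 ^ m * n. *)
Lemma reaches_ex (m : nat) (hm : (1 < m)%N) (n : nat) :
  exists s, `[< reaches m n s >].
Proof.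
case: m hm => [//|[//|m]] _; case: n => [|n].
  exists 0%N; apply/asboolP; exists [::]; split=> //; split=> //.
    by exists 0%N; rewrite big_seq1 expr0n.
  by move=> z /=; rewrite addn0; case: (_ == _).
pose k := (2 ^ m.+2 * n.+1)%N.
have ltnk : (n.+1 < k)%N by rewrite ltn_Pmull // -{1}(expn0 2) ltn_exp2l.
have lastE j (y : int) : last y (nseq j y) = y by elim: j.
have sortE j (y : int) : path <=%R y (nseq j y).
  by elim: j => //= j ->; rewrite lexx.
exists k; apply/asboolP; exists (nseq m.+1 k%:Z); split; last exact: lastE.
split.
- by rewrite /= lez_nat ltnW ?sortE.
- exists (n.+1 * 2 ^ m.+1)%N.
  rewrite big_cons big_nseq iter_mulr_1 -!natz -!natrX -natrM.
  congr (_%:R); rewrite /k (expnMn n.+1) (expnMn (2 ^ m.+2)) -!expnM.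
  by rewrite mulnCA -(expnS n.+1 m.+1) (mulnC m.+2) (mulnC (_ ^ _)%N).
- move=> z /=; rewrite count_nseq /=.
  case: eqP => [<-|_]; last by case: (_ == _); rewrite ?mul1n ?mul0n.
  by rewrite eqz_nat (gtn_eqF ltnk).
Qed.

Definition g (m : nat) (hm : (1 < m)%N) (n : nat) : nat :=
  ex_minn (reaches_ex hm n).

(* Main.v *)
(** Multiplicities in an m-product sequence of positive integers only matter
    modulo m, and for m prime the nonzero ones are invertible.  The last term is
    never a prime p: the p-adic valuation of the product would be the
    multiplicity of p, which is not divisible by m.  Conversely, a composite
    x = a b is the last term of the reduction modulo m of the sequence made of x
    and m - 1 copies of each of a and b.  Among the sequences of positive
    integers with last term x, take one, A, with maximal first term n.  If some
    sequence B from n ended below x, then A together with c copies of B, with c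
    chosen to cancel n modulo m, would reduce to a sequence from a larger first
    term to x. *)
Require Import Defs.
From mathcomp Require Import all_boot all_order ssralg ssrnum ssrint boolp.

Set Implicit Arguments.
Unset Strict Implicit.
Unset Printing Implicit Defensive.

Import Order.TTheory GRing.Theory Num.Theory.

Lemma count_flatten_nseq (T : eqType) (f : T -> nat) (r : seq T) (x : T) :
  uniq r -> count_mem x (flatten [seq nseq (f y) y | y <- r]) = (x \in r) * f x.
Proof.
elim: r => //= y r IHr /andP[yr /IHr {}IHr].
rewrite count_cat count_nseq IHr /= in_cons eq_sym.
by case: eqVneq => [->|_]; rewrite ?(negPf yr) ?addn0 ?mul0n ?add0n.
Qed.

Lemma count_flatten_copies (T : eqType) (c : nat) (s : seq T) (x : T) :
  count_mem x (flatten (nseq c s)) = c * count_mem x s.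
Proof. by elim: c => //= c IHc; rewrite count_cat IHc mulSn. Qed.

Lemma prod_flatten_copies (c : nat) (s : seq nat) :
  \prod_(k <- flatten (nseq c s)) k = (\prod_(k <- s) k) ^ c.
Proof. by elim: c => [|c IHc] /=; rewrite ?big_nil // big_cat IHc expnS. Qed.

(** Split each multiplicity into its remainder plus [m] times its quotient. The quotients contribute
    the [m]-th power of the product of [t], which is positive because 0 is not in [s]. This power
    divides [R ^ m], so the product of [t] divides [R] and its power cancels. *)
Lemma reduce_mod (m : nat) (s : seq nat) :
  0 < m -> 0 \notin s -> (exists R, \prod_(k <- s) k = R ^ m) ->
  exists s' : seq nat,
    (forall k, count_mem k s' = count_mem k s %% m) /\
    exists R, \prod_(k <- s') k = R ^ m.
Proof.
move=> m_gt0 s0 [R defR].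
pose spread (f : nat -> nat) := flatten [seq nseq (f k) k | k <- undup s].
have countE f k : count_mem k (spread f) = (k \in s) * f k.
  by rewrite count_flatten_nseq ?undup_uniq // mem_undup.
pose s' := spread (fun k => count_mem k s %% m).
pose t := spread (fun k => count_mem k s %/ m).
exists s'; split=> [k|].
  rewrite countE; case: (boolP (k \in s)) => [_|/count_memPn ->].
    by rewrite mul1n.
  by rewrite mod0n.
have t_gt0 : 0 < \prod_(k <- t) k.
  rewrite big_seq prodn_cond_gt0 // => k.
  rewrite lt0n -has_pred1 has_count countE.
  by case: (boolP (k \in s)) => // ks _; apply: contraNneq s0 => <-.
have : \prod_(k <- s) k = \prod_(k <- s') k * (\prod_(k <- t) k) ^ m.
  rewrite -prod_flatten_copies -big_cat; apply: perm_big.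
  apply/allP => k _ /=; rewrite count_cat count_flatten_copies !countE.
  case: (boolP (k \in s)) => [_|/count_memPn ->]; last by rewrite muln0.
  by rewrite !mul1n addnC mulnC -divn_eq.
rewrite defR => defRm.
have /dvdnP[q defq] : \prod_(k <- t) k %| R.
  by rewrite -(@dvdn_pexp2r _ _ m) // defRm dvdn_mull.
exists q; apply/eqP.
by rewrite -(eqn_pmul2r (_ : 0 < (\prod_(k <- t) k) ^ m)) ?expn_gt0 ?t_gt0 //
  -defRm -expnMn -defq.
Qed.

Lemma leq_last_path (n : nat) (s : seq nat) (k : nat) :
  path leq n s -> k \in n :: s -> k <= last n s.
Proof.
elim: s n k => [n k _|a s IHs n k /= /andP[na pas]]; first by rewrite inE => /eqP->.
rewrite in_cons => /predU1P[->|/(IHs _ _ pas)//].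
exact: leq_trans na (IHs _ _ pas (mem_head _ _)).
Qed.

(** A sorted sequence starting at a natural number has no negative entry, so it amounts to a
    multiset of naturals with minimum [n] and maximum [x]. In this form sequences can be merged
    without regard to order. *)
Lemma reachesP (m n x : nat) :
  0 < m ->
  reaches m n x <-> exists s : seq nat,
    [/\ n \in s, x \in s, forall k, k \in s -> n <= k <= x,
        forall k, count_mem k s < m & exists R, \prod_(k <- s) k = R ^ m].
Proof.
move=> m_gt0; have prodE (s : seq nat) :
    (\prod_(z <- map Posz s) z)%R = Posz (\prod_(k <- s) k).
  by elim: s => [|k s IHs] /=; rewrite ?big_nil // !big_cons IHs PoszM.
split=> [[b [[sb [R defR] cb] lastb]]|[s [ns xs boundS cs [R defR]]]].
  have [c defb] : exists c, b = map Posz c.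
    exists (map absz b); rewrite -map_comp -[LHS]map_id.
    apply/eq_in_map => z zb /=; rewrite gez0_abs //.
    have := order_path_min le_trans sb => /allP/(_ _ zb).
    exact: le_trans.
  move: sb defR cb lastb; rewrite {}defb -(map_cons Posz n c) => sb defR cb.
  rewrite last_map => -[lastc].
  have sc : sorted leq (n :: c) by rewrite -(mono_sorted lez_nat).
  exists (n :: c); split.
  - exact: mem_head.
  - by rewrite -lastc mem_last.
  - move=> k kc; apply/andP; split.
      move: kc; rewrite in_cons => /predU1P[-> //|].
      by have /allP := order_path_min leq_trans sc; apply.
    by rewrite -lastc leq_last_path.
  - move=> k; rewrite -(prednK m_gt0) ltnS.
    by have := cb (Posz k); rewrite count_map; congr (_ <= _).
  - exists R; apply/eqP; rewrite -eqz_nat -prodE defR.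
    by rewrite -!natz -natrX.
have [n0 [b defs]] : exists n0 b, sort leq s = n0 :: b.
  case: (sort leq s) (mem_sort leq s n) => [|n0 b] memn; last by exists n0, b.
  by rewrite ns in memn.
have memE k : (k \in n0 :: b) = (k \in s) by rewrite -defs mem_sort.
have sb : sorted leq (n0 :: b) by rewrite -defs sort_sorted //; exact: leq_total.
have def_n0 : n0 = n.
  apply/eqP; rewrite eqn_leq andbC.
  have /boundS/andP[-> _] /= : n0 \in s by rewrite -memE mem_head.
  have : n \in n0 :: b by rewrite memE.
  rewrite in_cons => /predU1P[->//|].
  by have /allP := order_path_min leq_trans sb; apply.
move: defs memE sb; rewrite {n0}def_n0 => defs memE sb.
exists (map Posz b); split; last first.
  rewrite last_map; congr Posz; apply/eqP; rewrite eqn_leq.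
  have /boundS/andP[_ ->] /= : last n b \in s by rewrite -memE mem_last.
  by rewrite leq_last_path // memE.
have defE : Posz n :: map Posz b = map Posz (sort leq s) by rewrite defs.
split.
- by rewrite -(map_cons Posz n b) (mono_sorted lez_nat).
- exists R; rewrite defE prodE (perm_big s) ?perm_sort //= defR.
  by rewrite -!natz -natrX.
- move=> z; rewrite -ltnS prednK // defE count_map.
  have /permP -> : perm_eq (sort leq s) s by rewrite perm_sort.
  case: z => k; first by rewrite (eq_count (a2 := pred1 k)).
  by rewrite (eq_count (a2 := pred0)) // count_pred0.
Qed.

(** After reduction only the values whose multiplicity is not divisible by [m] survive, so bounds
    are asked of these alone. The least survivor becomes the first term. *)
Lemma reaches_of_product (m l x : nat) (s : seq nat) :
  0 < m -> 0 < l -> (forall k, ~~ (m %| count_mem k s) -> l <= k <= x) ->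
  0 \notin s -> (exists R, \prod_(k <- s) k = R ^ m) ->
  ~~ (m %| count_mem x s) ->
  exists2 n, l <= n & reaches m n x.
Proof.
move=> m_gt0 l_gt0 boundS s0 prodS xs.
have [s' [cs' prodS']] := reduce_mod m_gt0 s0 prodS.
have memE k : (k \in s') = ~~ (m %| count_mem k s).
  by rewrite -has_pred1 has_count cs' lt0n.
have exs : exists k, k \in s' by exists x; rewrite memE.
case: (ex_minnP exs) => n ns' min_n; exists n.
  by move: ns'; rewrite memE => /boundS/andP[].
apply/reachesP => //; exists s'; split=> //.
- by rewrite memE.
- by move=> k ks'; rewrite min_n //; move: ks'; rewrite memE => /boundS/andP[].
- by move=> k; rewrite cs' ltn_pmod.
Qed.

Lemma reaches_leq (m n x : nat) : 0 < m -> reaches m n x -> n <= x.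
Proof. by move=> m_gt0 /(reachesP _ _ m_gt0)[s [_ /[swap] /[apply]/andP[]]]. Qed.

Lemma not_reaches_prime (m n p : nat) :
  0 < m -> 0 < n -> prime p -> ~ reaches m n p.
Proof.
move=> m_gt0 n_gt0 p_pr /(reachesP _ _ m_gt0)[s [_ ps boundS cs [R defR]]].
(* Entries are positive and at most [p], so [p] divides only those equal to [p], each of valuation
   1. *)
have lognE : logn p (\prod_(k <- s) k) = count_mem p s /\ 0 < \prod_(k <- s) k.
  elim: s boundS {ps cs defR} => [|k s IHs] boundS; first by rewrite big_nil logn1.
  have [|IHl IHp] := IHs; first by move=> j js; rewrite boundS // in_cons js orbT.
  have /andP[nk kp] := boundS k (mem_head _ _).
  have k_gt0 := leq_trans n_gt0 nk.
  rewrite big_cons muln_gt0 k_gt0 IHp lognM // IHl /=; split=> //.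
  congr (_ + _); case: eqVneq => [->|pk]; first by rewrite logn_prime ?eqxx.
  apply/eqP; rewrite eqn0Ngt logn_gt0 mem_primes p_pr k_gt0 /=.
  by rewrite gtnNdvd // ltn_neqAle pk.
have : m %| count_mem p s by rewrite -lognE.1 defR lognX dvdn_mulr.
by rewrite gtnNdvd // -has_count has_pred1.
Qed.

Lemma exists_reaches (m x : nat) :
  1 < m -> 0 < x -> ~~ prime x -> exists2 n, 0 < n & reaches m n x.
Proof.
move=> m_gt1 x_gt0 /primePn x_npr; have m_gt0 := ltnW m_gt1.
(* 1 is neither prime nor composite; the one-term sequence 1 serves for it. *)
have /predU1P[x1|x_gt1] : (x == 1) || (1 < x) by rewrite eq_sym -leq_eqVlt.
  apply: (@reaches_of_product _ _ _ [:: 1]) => //.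
  - move=> k; rewrite x1 /= addn0; by case: eqVneq => [<-|_]; rewrite ?dvdn0 ?dvdn1.
  - by exists 1; rewrite big_seq1 exp1n.
  - by rewrite x1 /= dvdn1 gtn_eqF.
case: x_npr => [|[d /andP[d_gt1 d_ltx] /dvdnP[q defx]]].
  by rewrite ltnNge x_gt1.
have q_gt1 : 1 < q.
  rewrite ltnNge; apply: contraTN d_ltx => q_le1; rewrite -leqNgt defx.
  by rewrite -[leqRHS]mul1n leq_mul2r q_le1 orbT.
have q_ltx : q < x by rewrite defx ltn_Pmulr // ltnW.
have d_gt0 := ltnW d_gt1; have q_gt0 := ltnW q_gt1.
(* The product is [x * (d * q) ^ m.-1 = x ^ m]. If [d = q], this value occurs [2 * m.-1] times,
   which the reduction modulo [m] allows. *)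
apply: (@reaches_of_product _ _ _ (x :: nseq m.-1 d ++ nseq m.-1 q)) => //.
- move=> k kS; suff : k \in x :: nseq m.-1 d ++ nseq m.-1 q.
    rewrite in_cons mem_cat !mem_nseq.
    by case/or3P => [/eqP->|/andP[_ /eqP->]|/andP[_ /eqP->]];
      rewrite ?x_gt0 ?d_gt0 ?q_gt0 ?leqnn //= ltnW.
  by apply: contraR kS => /count_memPn ->; rewrite dvdn0.
- rewrite in_cons mem_cat !mem_nseq.
  by rewrite !(eq_sym 0) !gtn_eqF // !andbF.
- exists x; rewrite big_cons big_cat !big_nseq !iter_muln_1 /=.
  by rewrite -expnMn (mulnC d) -defx -expnS prednK.
- by rewrite /= eqxx count_cat !count_nseq /= !ltn_eqF // !mul0n dvdn1 gtn_eqF.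
Qed.

Lemma prime_cancel (m a b : nat) :
  prime m -> 0 < b < m -> exists c, m %| a + c * b.
Proof.
move=> m_pr /andP[b_gt0 b_ltm].
case: (egcdnP m b_gt0) => u v.
have /eqP -> : coprime b m by rewrite coprime_sym prime_coprime // gtnNdvd.
(* [u] is an inverse of [b] modulo [m] and [m.-1] acts as -1, so [c * b] is congruent to [-a]. *)
move=> def1 _; exists (u * (m.-1 * a)).
rewrite mulnAC def1 mulnDl mul1n addnCA -mulSn prednK ?prime_gt0 //.
by rewrite -mulnA mulnCA -mulnDr dvdn_mulr.
Qed.

Lemma reaches_cancel (m n x y : nat) :
  prime m -> 0 < n -> reaches m n x -> reaches m n y -> y < x ->
  exists2 n', n < n' & reaches m n' x.
Proof.
move=> m_pr n_gt0; have m_gt0 := prime_gt0 m_pr.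
case/(reachesP _ _ m_gt0) => sA [nA xA boundA cA [RA prodA]].
case/(reachesP _ _ m_gt0) => sB [nB yB boundB cB [RB prodB]] yx.
have [|c dvd_c] := @prime_cancel m (count_mem n sA) (count_mem n sB) m_pr.
  by rewrite cB -has_count has_pred1 nB.
have countE k : count_mem k (sA ++ flatten (nseq c sB)) =
    count_mem k sA + c * count_mem k sB.
  by rewrite count_cat count_flatten_copies.
have notinB k : ~~ (n <= k <= y) -> count_mem k sB = 0.
  by move=> nk; apply/count_memPn; apply: contra nk => /boundB.
have notinA k : ~~ (n <= k <= x) -> count_mem k sA = 0.
  by move=> nk; apply/count_memPn; apply: contra nk => /boundA.
(* The lower bound is [n.+1]: nothing below [n] occurs, and [c] makes the multiplicity of [n]
   divisible by [m]. *)
apply: (@reaches_of_product _ _ _ (sA ++ flatten (nseq c sB))) => //.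
- move=> k; apply: contraR; rewrite countE => kS.
  have [->//|nk] := eqVneq k n.
  have lowk : ~~ (n <= k <= x) by rewrite leq_eqVlt eq_sym (negPf nk).
  rewrite notinA // notinB ?muln0 ?dvdn0 //; apply: contra lowk => /andP[-> /=].
  by move/leq_trans; apply; apply: ltnW.
- by apply/count_memPn; rewrite countE notinA ?notinB ?muln0 // leqn0 gtn_eqF.
- by exists (RA * RB ^ c); rewrite big_cat prod_flatten_copies prodA prodB /=
    expnMn -!expnM (mulnC c).
(* Since [y < x], the value [x] is absent from [sB] and keeps its multiplicity in [sA], strictly
   between 0 and [m]. *)
- rewrite countE (notinB x) ?muln0 ?addn0; last by rewrite negb_and -!ltnNge yx orbT.
  by rewrite gtnNdvd // -has_count has_pred1.
Qed.

Theorem theorem5p5 (m : nat) (hm : prime m) :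
  (forall n : nat, ~~ prime (g (prime_gt1 hm) n)) /\
  (forall x : nat, ~~ prime x -> exists n : nat, g (prime_gt1 hm) n = x).
Proof.
have m_gt0 := prime_gt0 hm.
(* The reduction modulo [m] excludes zero entries, so the value 0 is obtained separately, from the
   one-term sequence 0. *)
have g0 : g (prime_gt1 hm) 0 = 0.
  rewrite /g; case: ex_minnP => s _ min_s; apply/eqP; rewrite -leqn0; apply: min_s.
  apply/asboolP/reachesP => //; exists [:: 0]; split=> //.
  - by move=> k; rewrite inE => /eqP->.
  - by move=> k /=; rewrite addn0; case: eqP; rewrite ?prime_gt1.
  - by exists 0; rewrite big_seq1 exp0n.
split=> [[|n]|[|x] x_npr]; first by rewrite g0.
- rewrite /g; case: ex_minnP => p /asboolP p_reached _.
  by apply/negP => p_pr; exact: not_reaches_prime m_gt0 (ltn0Sn n) p_pr p_reached.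
- by exists 0.
have [n1 n1_gt0 n1x] := exists_reaches (prime_gt1 hm) (ltn0Sn x) x_npr.
(* First terms of sequences ending at [x.+1] are at most [x.+1], so a largest positive one
   exists. *)
pose P n := (0 < n) && `[< reaches m n x.+1 >].
have exP : exists n, P n by exists n1; rewrite /P n1_gt0; apply/asboolP.
have ubP n : P n -> n <= x.+1 by case/andP=> _ /asboolP; exact: reaches_leq.
case: (ex_maxnP exP ubP) => n /andP[n_gt0 /asboolP nx] max_n.
exists n; rewrite /g; case: ex_minnP => y /asboolP ny min_y.
apply/eqP; rewrite eqn_leq min_y; last exact/asboolP.
rewrite leqNgt; apply/negP => /(reaches_cancel hm n_gt0 nx ny)[n' nn' n'x].
have := max_n n'; rewrite leqNgt nn' /P (leq_trans _ nn') //= => maxn'.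
by have /asboolP/maxn' := n'x.
Qed.
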